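(* Let $\mathcal{H}_{\mathcal{S}}$ and $\mathcal{H}_{\mathcal{E}}$ be complex Hilbert spaces of finite dimensions $d\ge 2$ and $n$, let $(|i\rangle)_{1\le i\le d}$ be an orthonormal basis of $\mathcal{H}_{\mathcal{S}}$, let $|\mathcal{E}_0\rangle\in\mathcal{H}_{\mathcal{E}}$ be a unit vector, and suppose that the joint unitary evolution conserves this basis, i.e. for every time $t$ there are unit vectors $|\mathcal{E}_1(t)\rangle,\dots,|\mathcal{E}_d(t)\rangle\in\mathcal{H}_{\mathcal{E}}$ such that every initial state $|\Psi_{\mathcal{S}}(0)\rangle\otimes|\mathcal{E}_0\rangle$ with $|\Psi_{\mathcal{S}}(0)\rangle=\sum_{i=1}^d c_i|i\rangle$, $\sum_i|c_i|^2=1$, evolves at time $t$ into $|\Psi(t)\rangle=\sum_{i=1}^d c_i\,|i\rangle\otimes|\mathcal{E}_i(t)\rangle$. Let $\rho_{\mathcal{S}}(t)=\mathrm{tr}_{\mathcal{E}}|\Psi(t)\rangle\langle\Psi(t)|$ and let $\rho_{\mathcal{S}}^{(d)}=\sum_{i=1}^d|c_i|^2|i\rangle\langle i|$ be its diagonal part in the basis $(|i\rangle)_i$. Let $S(\rho)=1-\mathrm{tr}(\rho^2)$ denote the linear entropy. Then for every time $t$, every initial state of $\mathcal{S}$, and every subspace $F\subset\mathcal{H}_{\mathcal{S}}$, with $\Pi_F$ the orthogonal projector onto $F$, $$\left|\mathrm{tr}(\rho_{\mathcal{S}}(t)\Pi_F)-\mathrm{tr}(\rho_{\mathcal{S}}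^{(d)}\Pi_F)\right|\le\dim(F)\,\sqrt{1-\inf_{|\Psi_{\mathcal{S}}(0)\rangle}\frac{S(\rho_{\mathcal{S}}(t))}{S(\rho_{\mathcal{S}}^{(d)})}}.$$
   Context: In the infimum, $|\Psi_{\mathcal{S}}(0)\rangle=\sum_i c_i|i\rangle$ ranges over all unit vectors of $\mathcal{H}_{\mathcal{S}}$ for which the ratio is defined, i.e. $S(\rho_{\mathcal{S}}^{(d)})\neq 0$ (at least two of the $c_i$ are nonzero). The matrices $\rho_{\mathcal{S}}(t)$ and $\rho_{\mathcal{S}}^{(d)}$ inside the infimum are those associated with this varying initial state, while the time $t$ and the vectors $|\mathcal{E}_i(t)\rangle$ (which do not depend on the $c_i$) are kept fixed. $\mathrm{tr}_{\mathcal{E}}$ denotes the partial trace over $\mathcal{H}_{\mathcal{E}}$. *)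

(* Defs.v *)
From mathcomp Require Import all_boot all_order all_algebra.
From mathcomp Require Import classical_sets reals.
From mathcomp Require Import complex mxtens.

Set Implicit Arguments.
Unset Strict Implicit.
Unset Printing Implicit Defensive.

Import Order.TTheory GRing.Theory Num.Theory.
Local Open Scope ring_scope.
Local Open Scope complex_scope.
Local Open Scope sesquilinear_scope.
Local Open Scope classical_set_scope.

(* Kets are column vectors over C = R[i]; C^d carries its standard Hermitian
   inner product, linear in the second argument, and C^d (x) C^n is identified
   with C^(d * n) through the Kronecker product [tensmx]. *)

Definition braket (R : realType) d (u v : 'cV[R[i]]_d) : R[i] :=
  (u ^t* *m v) 0 0.

Definition ketbra (R : realType) d (u v : 'cV[R[i]]_d) : 'M[R[i]]_d :=
  u *m v ^t*.

(* A d-element orthonormal family of C^d is automatically a basis. *)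
Definition orthonormal_basis (R : realType) d (e : 'I_d -> 'cV[R[i]]_d) : Prop :=
  forall i j, braket (e i) (e j) = (i == j)%:R.

(* The ascription casts the 1 * 1 columns produced by [tensmx] to 1. *)
Definition tensket (R : realType) d n (u : 'cV[R[i]]_d) (v : 'cV[R[i]]_n) :
    'cV[R[i]]_(d * n) :=
  tensmx u v.

Definition ptraceE (R : realType) d n (M : 'M[R[i]]_(d * n)) : 'M[R[i]]_d :=
  \matrix_(i, j) \sum_(k < n) M (mxtens_index (i, k)) (mxtens_index (j, k)).

Definition normalized (R : realType) d (c : 'I_d -> R[i]) : Prop :=
  \sum_i `|c i| ^+ 2 = 1.

Definition superpose (R : realType) d (e : 'I_d -> 'cV[R[i]]_d)
    (c : 'I_d -> R[i]) : 'cV[R[i]]_d :=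
  \sum_i c i *: e i.

(* [U t] maps the joint state at the initial time to the joint state at time
   [t]. *)
Definition unitary_evolution (R : realType) m (U : R -> 'M[R[i]]_m) : Prop :=
  forall t, U t \is unitarymx.

Definition joint_state (R : realType) d n (U : R -> 'M[R[i]]_(d * n))
    (e : 'I_d -> 'cV[R[i]]_d) (E0 : 'cV[R[i]]_n) (t : R) (c : 'I_d -> R[i]) :
    'cV[R[i]]_(d * n) :=
  U t *m tensket (superpose e c) E0.

Definition conserves_basis (R : realType) d n (U : R -> 'M[R[i]]_(d * n))
    (e : 'I_d -> 'cV[R[i]]_d) (E0 : 'cV[R[i]]_n) : Prop :=
  forall t, exists E : 'I_d -> 'cV[R[i]]_n,
    (forall i, braket (E i) (E i) = 1) /\
    forall c, normalized c ->
      joint_state U e E0 t c = \sum_i c i *: tensket (e i) (E i).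

Definition rhoS (R : realType) d n (U : R -> 'M[R[i]]_(d * n))
    (e : 'I_d -> 'cV[R[i]]_d) (E0 : 'cV[R[i]]_n) (t : R) (c : 'I_d -> R[i]) :
    'M[R[i]]_d :=
  let Psi := joint_state U e E0 t c in ptraceE (ketbra Psi Psi).

Definition rhoS_diag (R : realType) d (e : 'I_d -> 'cV[R[i]]_d)
    (c : 'I_d -> R[i]) : 'M[R[i]]_d :=
  \sum_i `|c i| ^+ 2 *: ketbra (e i) (e i).

(* For a Hermitian rho, tr (rho^2) is real, so taking the real part only
   changes the type. *)
Definition linear_entropy (R : realType) d (rho : 'M[R[i]]_d) : R :=
  complex.Re (1 - \tr (rho *m rho)).

Definition entropy_ratios (R : realType) d n (U : R -> 'M[R[i]]_(d * n))
    (e : 'I_d -> 'cV[R[i]]_d) (E0 : 'cV[R[i]]_n) (t : R) : set R :=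
  [set r | exists c : 'I_d -> R[i],
     [/\ normalized c,
         linear_entropy (rhoS_diag e c) != 0 &
         r = linear_entropy (rhoS U e E0 t c) /
             linear_entropy (rhoS_diag e c)]].

(* P x is the orthogonal projection of x on F for every x; this determines
   the matrix P. *)
Definition orthogonal_projector (R : realType) d (F : {vspace 'cV[R[i]]_d})
    (P : 'M[R[i]]_d) : Prop :=
  forall x : 'cV[R[i]]_d,
    P *m x \in F /\ forall y, y \in F -> braket y (x - P *m x) = 0.

(* Main.v *)
Require Import Defs.
From mathcomp Require Import all_boot all_order all_algebra.
From mathcomp Require Import classical_sets reals.
From mathcomp Require Import complex mxtens.

From mathcomp Require Import ring.

Import Order.TTheory GRing.Theory Num.Theory.
Local Open Scope ring_scope.
Local Open Scope sesquilinear_scope.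

(** The coherences [rho - rho_d] have entries [c_a (c_b)^* <E_b|E_a>] with
   [a <> b] in the basis [e]. On an equal superposition of two basis vectors
   [e_a], [e_b] the entropy ratio equals [1 - |<E_b|E_a>|^2], so
   [eta := 1 - inf] bounds every [|<E_b|E_a>|^2] with [a <> b]; hence the
   Frobenius norm of the coherences is at most [sqrt eta]. By Cauchy-Schwarz
   for the trace form the left-hand side is at most [sqrt eta] times the
   Frobenius norm [sqrt (dim F)] of the projector. *)

(** * Frobenius norm, trace form and weighted Gram matrices *)

Section MatrixTrace.
Context {C : numClosedFieldType}.

Definition frobenius_sqr {m n} (A : 'M[C]_(m, n)) : C :=
  \sum_i \sum_j `|A i j| ^+ 2.

Lemma sum_CauchySchwarz (I : finType) (x y : I -> C) :
  `|\sum_i x i * y i| ^+ 2 <= (\sum_i `|x i| ^+ 2) * (\sum_i `|y i| ^+ 2).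
Proof.
pose vec (u : I -> C) := \row_(k < #|I|) u (enum_val k).
have dotE (u v : I -> C) : dotmx (vec u) (vec v) = \sum_i u i * (v i)^*.
  rewrite dotmxE mxE [RHS](eq_bigl (mem I)) // [RHS]big_enum_val.
  by apply: eq_bigr => k _; rewrite !mxE.
(* Conjugating [y] beforehand cancels the conjugation that [dotmx] puts on its second argument. *)
pose z i := (y i)^*.
have : `|dotmx (vec x) (vec z)| ^+ 2
    <= dotmx (vec x) (vec x) * dotmx (vec z) (vec z).
  by have [] := CauchySchwarz (@dotmx C #|I|) (vec x) (vec z).
rewrite !dotE /z.
have -> : \sum_i x i * ((y i)^*)^* = \sum_i x i * y i.
  by apply: eq_bigr => i _; rewrite conjCK.
have -> : \sum_i x i * (x i)^* = \sum_i `|x i| ^+ 2.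
  by apply: eq_bigr => i _; rewrite normCK.
have -> // : \sum_i (y i)^* * ((y i)^*)^* = \sum_i `|y i| ^+ 2.
by apply: eq_bigr => i _; rewrite -normCK norm_conjC.
Qed.

Lemma trmulmx_CauchySchwarz {m n} (A : 'M[C]_(m, n)) (B : 'M[C]_(n, m)) :
  `|\tr (A *m B)| ^+ 2 <= frobenius_sqr A * frobenius_sqr B.
Proof.
have -> : \tr (A *m B) = \sum_p A p.1 p.2 * B p.2 p.1.
  by rewrite /mxtrace -(pair_bigA _ (fun i j => A i j * B j i));
    apply: eq_bigr => i _; rewrite mxE.
have -> : frobenius_sqr A = \sum_p `|A p.1 p.2| ^+ 2.
  exact: (pair_bigA _ (fun i j => `|A i j| ^+ 2)).
have -> : frobenius_sqr B = \sum_p `|B p.2 p.1| ^+ 2.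
  rewrite /frobenius_sqr exchange_big.
  exact: (pair_bigA _ (fun i j => `|B j i| ^+ 2)).
exact: sum_CauchySchwarz.
Qed.

Lemma frobenius_sqrE {m n} (A : 'M[C]_(m, n)) :
  frobenius_sqr A = \tr (A ^t* *m A).
Proof.
rewrite /frobenius_sqr exchange_big; apply: eq_bigr => j _.
by rewrite mxE; apply: eq_bigr => i _; rewrite !mxE normCKC.
Qed.

Lemma frobenius_sqr_ge0 {m n} (A : 'M[C]_(m, n)) : 0 <= frobenius_sqr A.
Proof. by apply: sumr_ge0 => i _; apply: sumr_ge0 => j _; exact: exprn_ge0. Qed.

Lemma trmxC_mul {m n p} (A : 'M[C]_(m, n)) (B : 'M[C]_(n, p)) :
  (A *m B) ^t* = B ^t* *m A ^t*.
Proof. by rewrite trmx_mul map_mxM. Qed.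

(* With [G a b = <E_b|E_a>] this is the reduced state in the basis [e]; with
   [G = 1] it is its diagonal part. *)
Definition schur_state {d} (c : 'I_d -> C) (G : 'M[C]_d) : 'M[C]_d :=
  \matrix_(a, b) (c a * (c b)^* * G a b).

Lemma frobenius_schur_state {d} (c : 'I_d -> C) (G : 'M[C]_d) :
  frobenius_sqr (schur_state c G)
  = \sum_a `|c a| ^+ 2 * \sum_b `|c b| ^+ 2 * `|G a b| ^+ 2.
Proof.
apply: eq_bigr => a _; rewrite mulr_sumr; apply: eq_bigr => b _.
by rewrite mxE !normrM norm_conjC !exprMn mulrA.
Qed.

Lemma schur_stateB {d} (c : 'I_d -> C) (G H : 'M[C]_d) :
  schur_state c G - schur_state c H = schur_state c (G - H).
Proof. by apply/matrixP => a b; rewrite !mxE mulrBr. Qed.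

Lemma schur_state_herm {d} (c : 'I_d -> C) (G : 'M[C]_d) :
  G ^t* = G -> (schur_state c G) ^t* = schur_state c G.
Proof.
move=> hG; apply/matrixP => a b; rewrite !mxE.
have /matrixP/(_ a b) := hG; rewrite !mxE => <-.
by rewrite !rmorphM /= conjCK [X in X * _ = _]mulrC.
Qed.

(** The weights [|c a|^2 |c b|^2] sum to 1 over all pairs, so the squared norm is an average of the
    [|G a b|^2]. *)
Lemma frobenius_schur_state_le {d} (c : 'I_d -> C) (G : 'M[C]_d) (h : C) :
    \sum_i `|c i| ^+ 2 = 1 -> (forall a b, `|G a b| ^+ 2 <= h) ->
  frobenius_sqr (schur_state c G) <= h.
Proof.
move=> hc hG; rewrite frobenius_schur_state -[leRHS]mul1r -hc mulr_suml.
apply: ler_sum => a _; apply: ler_wpM2l; first exact: exprn_ge0.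
rewrite -[leRHS]mul1r -hc mulr_suml; apply: ler_sum => b _.
by apply: ler_wpM2l => //; exact: exprn_ge0.
Qed.

End MatrixTrace.

(** * Kets and orthogonal projectors *)

Section Kets.
Context {R : realType}.
Local Notation C := (complex R).

Lemma braketE {d} (u v : 'cV[C]_d) : braket u v = \sum_k (u k 0)^* * v k 0.
Proof. by rewrite /braket mxE; apply: eq_bigr => k _; rewrite !mxE. Qed.

Lemma braketC {d} (u v : 'cV[C]_d) : (braket u v)^* = braket v u.
Proof.
rewrite !braketE rmorph_sum; apply: eq_bigr => k _.
by rewrite rmorphM /= conjCK mulrC.
Qed.

Lemma braket_CauchySchwarz {d} (u v : 'cV[C]_d) :
  `|braket u v| ^+ 2 <= braket u u * braket v v.
Proof.
rewrite !braketE; have := sum_CauchySchwarz _ (fun k => (u k 0)^*) (v^~ 0).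
under [X in X * _]eq_bigr do rewrite norm_conjC normCKC.
by under [X in _ * X]eq_bigr do rewrite normCKC.
Qed.

Lemma braket_eq0 {d} (u : 'cV[C]_d) : braket u u = 0 -> u = 0.
Proof.
rewrite braketE; under eq_bigr do rewrite -normCKC.
move/eqP; rewrite psumr_eq0 => [/allP h|k _]; last exact: exprn_ge0.
apply/colP => k; have := h k; rewrite mem_index_enum mxE => /(_ isT).
by rewrite /= expf_eq0 /= normr_eq0 => /eqP.
Qed.

Lemma tensketE {d n} (u : 'cV[C]_d) (v : 'cV[C]_n) i k :
  tensket u v (mxtens_index (i, k)) 0 = u i 0 * v k 0.
Proof.
by rewrite /tensket /tensmx mxE mxtens_indexK /= !ord1.
Qed.

(** Since [x - P x] is orthogonal to every [P z], the adjoint of [P] equals [P ^t* *m P]; this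
    product is Hermitian, hence so is [P]. The first identity is stated in the form that turns the
    squared Frobenius norm of [P] into its trace. *)
Lemma orthogonal_projector_gram_trace {d} (F : {vspace 'cV[C]_d}) (P : 'M[C]_d) :
  orthogonal_projector F P -> P ^t* *m P = P /\ \tr P = (\dim F)%:R.
Proof.
move=> hP.
have PF x : P *m x \in F by case: (hP x).
have Pid y : y \in F -> P *m y = y.
  move=> yF; apply/eqP; rewrite eq_sym -subr_eq0; apply/eqP/braket_eq0.
  by case: (hP y) => _; apply; rewrite memvB.
split.
  have orth (x z : 'cV[C]_d) : (P *m z) ^t* *m x = (P *m z) ^t* *m (P *m x).
    apply/eqP; rewrite -subr_eq0 -mulmxBr; apply/eqP/matrixP => i j.
    by rewrite !ord1 [RHS]mxE; case: (hP x) => _; apply.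
  have hPP : P ^t* = P ^t* *m P.
    have entry (A : 'M[C]_d) i j :
        A i j = (delta_mx (0 : 'I_1) i *m A *m delta_mx j (0 : 'I_1)) 0 0.
      by rewrite -rowE -colE !mxE.
    apply/matrixP => i j; rewrite !entry.
    have := orth (delta_mx j 0) (delta_mx i 0).
    by rewrite trmxC_mul trmx_delta map_delta_mx !mulmxA => ->.
  by rewrite -[RHS]trmxCK hPP trmxC_mul trmxCK -hPP.
(* [P] factors through coordinates in a basis of [F] as [B K] with [K B = 1]. *)
pose B := \matrix_(i < d, k < \dim F) (vbasis F)`_k i 0.
pose K := \matrix_(k < \dim F, j < d) coord (vbasis F) k (P *m delta_mx j 0).
have -> : P = B *m K.
  apply/matrixP => i j.
  have := coord_vbasis (PF (delta_mx j 0)) => /colP/(_ i).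
  rewrite -colE !mxE summxE => ->; apply: eq_bigr => k _.
  by rewrite !mxE colE mulrC.
rewrite mxtrace_mulC.
suff -> : K *m B = 1%:M by rewrite mxtrace1.
apply/matrixP => k l; rewrite !mxE.
(* Entry [(k, l)] of [K *m B] is the [k]-th coordinate of [P b_l], where [b_l] is the [l]-th basis
   vector of [F], and [P] fixes [b_l]. *)
rewrite eq_sym -(coord_free l k (basis_free (vbasisP F))).
rewrite -(Pid (vbasis F)`_l) ?vbasis_mem ?mem_nth ?size_tuple //.
rewrite [X in P *m X]matrix_sum_delta mulmx_sumr linear_sum.
apply: eq_bigr => j _.
by rewrite big_ord1 -scalemxAr linearZ /= !mxE mulrC.
Qed.

(** * Reduced states and their entropies in the basis [e] *)

Definition basis_mx {d} (e : 'I_d -> 'cV[C]_d) : 'M[C]_d :=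
  \matrix_(i, j) e j i 0.

Lemma basis_mxK {d} (e : 'I_d -> 'cV[C]_d) :
  orthonormal_basis e -> (basis_mx e) ^t* *m basis_mx e = 1%:M.
Proof.
move=> he; apply/matrixP => a b; rewrite [RHS]mxE -he braketE mxE.
by apply: eq_bigr => k _; rewrite !mxE.
Qed.

Definition gram {d n} (E : 'I_d -> 'cV[C]_n) : 'M[C]_d :=
  \matrix_(a, b) braket (E b) (E a).

Lemma gram_herm {d n} (E : 'I_d -> 'cV[C]_n) : (gram E) ^t* = gram E.
Proof. by apply/matrixP => a b; rewrite !mxE braketC. Qed.

Lemma gram_le1 {d n} (E : 'I_d -> 'cV[C]_n) a b :
  (forall i, braket (E i) (E i) = 1) -> `|gram E a b| ^+ 2 <= 1.
Proof.
by move=> hE; rewrite mxE (le_trans (braket_CauchySchwarz _ _)) // !hE mulr1.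
Qed.

Lemma conj_mxE {d} (e : 'I_d -> 'cV[C]_d) (A : 'M[C]_d) i j :
  (basis_mx e *m A *m (basis_mx e) ^t*) i j
  = \sum_b \sum_a e a i 0 * A a b * (e b j 0)^*.
Proof.
rewrite mxE; apply: eq_bigr => b _; rewrite mxE mulr_suml.
by apply: eq_bigr => a _; rewrite !mxE.
Qed.

(** Tracing out the environment attaches [<E_b|E_a>] to [|e_a><e_b|], which explains the swapped
    indices in [gram]. *)
Lemma rhoSE {d n} (U : R -> 'M[C]_(d * n)) (e : 'I_d -> 'cV[C]_d)
    (E0 : 'cV[C]_n) t c (E : 'I_d -> 'cV[C]_n) :
    joint_state U e E0 t c = \sum_i c i *: tensket (e i) (E i) ->
  rhoS U e E0 t c
  = basis_mx e *m schur_state c (gram E) *m (basis_mx e) ^t*.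
Proof.
rewrite /rhoS => ->; apply/matrixP => i j; rewrite conj_mxE mxE.
have PsiE l k : (\sum_i c i *: tensket (e i) (E i)) (mxtens_index (l, k)) 0
    = \sum_a c a * (e a l 0 * E a k 0).
  by rewrite summxE; apply: eq_bigr => a _; rewrite mxE tensketE.
under eq_bigr => k _.
  rewrite /ketbra mxE big_ord1 !mxE !PsiE rmorph_sum mulr_sumr.
  under eq_bigr do rewrite mulr_suml.
  over.
rewrite exchange_big; apply: eq_bigr => b _.
rewrite exchange_big; apply: eq_bigr => a _.
rewrite !mxE braketE mulr_sumr mulr_sumr mulr_suml; apply: eq_bigr => k _.
by rewrite !rmorphM /=; ring.
Qed.

Lemma rhoS_diagE {d} (e : 'I_d -> 'cV[C]_d) c :
  rhoS_diag e c = basis_mx e *m schur_state c 1%:M *m (basis_mx e) ^t*.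
Proof.
apply/matrixP => i j; rewrite conj_mxE summxE; apply: eq_bigr => b _.
rewrite (bigD1 b) //= big1 ?addr0 => [|a /negPf ab]; last first.
  by rewrite !mxE ab !mulr0 mul0r.
rewrite !mxE big_ord1 !mxE eqxx mulr1 normCK; ring.
Qed.

(** The change of basis is unitary and drops out of the trace. For a Hermitian matrix the trace of
    the square is the squared Frobenius norm, which is real, so taking the real part loses
    nothing. *)
Lemma linear_entropyE {d} (e : 'I_d -> 'cV[C]_d) c (G : 'M[C]_d) :
    orthonormal_basis e -> G ^t* = G ->
  (linear_entropy (basis_mx e *m schur_state c G *m (basis_mx e) ^t*))%:C%C
  = 1 - \sum_a `|c a| ^+ 2 * \sum_b `|c b| ^+ 2 * `|G a b| ^+ 2.
Proof.
move=> he hG; rewrite /linear_entropy.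
have -> : \tr (basis_mx e *m schur_state c G *m (basis_mx e) ^t*
    *m (basis_mx e *m schur_state c G *m (basis_mx e) ^t*))
    = frobenius_sqr (schur_state c G).
  rewrite frobenius_sqrE schur_state_herm // !mulmxA.
  rewrite -[_ *m _ ^t* *m basis_mx e]mulmxA basis_mxK // mulmx1.
  by rewrite mxtrace_mulC !mulmxA basis_mxK // mul1mx.
rewrite -frobenius_schur_state RRe_real // rpredB ?rpred1 //.
exact/ger0_real/frobenius_sqr_ge0.
Qed.

(** Applied to [gram E] and to the identity, this makes 0 a lower bound of the entropy ratios. *)
Lemma linear_entropy_ge0 {d} (e : 'I_d -> 'cV[C]_d) c (G : 'M[C]_d) :
    orthonormal_basis e -> G ^t* = G -> normalized c ->
    (forall a b, `|G a b| ^+ 2 <= 1) ->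
  0 <= linear_entropy (basis_mx e *m schur_state c G *m (basis_mx e) ^t*).
Proof.
move=> he hG hc hG1; rewrite -ler0c linear_entropyE // subr_ge0.
by rewrite -frobenius_schur_state; apply: frobenius_schur_state_le.
Qed.

(** * Two-level test states and the infimum *)

Definition pair_amplitude {d} (a b : 'I_d) (k : 'I_d) : C :=
  if (k == a) || (k == b) then (sqrtC 2)^-1 else 0.

Lemma sum_pair_amplitude {d} (a b : 'I_d) (f : 'I_d -> C) : a != b ->
  \sum_k `|pair_amplitude a b k| ^+ 2 * f k = (f a + f b) / 2.
Proof.
move=> ab; have half : `|(sqrtC 2 : C)^-1| ^+ 2 = 2^-1.
  by rewrite normfV exprVn -normrX sqrtCK normr_nat.
rewrite (bigD1 a) // (bigD1 b) 1?eq_sym //= big1 => [|k /andP[ka kb]].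
  by rewrite /pair_amplitude !eqxx orbT /= half addr0 -mulrDr mulrC.
by rewrite /pair_amplitude (negPf ka) (negPf kb) normr0 expr0n mul0r.
Qed.

Lemma normalized_pair_amplitude {d} (a b : 'I_d) :
  a != b -> normalized (pair_amplitude a b).
Proof.
move=> ab; have := sum_pair_amplitude a b (fun=> 1) ab.
by under eq_bigr do rewrite mulr1; rewrite /normalized => ->; field.
Qed.

(** The double sum averages four terms, namely 1 twice and [|G a b|^2] twice. *)
Lemma linear_entropy_pair {d} (e : 'I_d -> 'cV[C]_d) a b (G : 'M[C]_d) :
    orthonormal_basis e -> G ^t* = G -> a != b ->
    G a a = 1 -> G b b = 1 ->
  (linear_entropy (basis_mx e *m schur_state (pair_amplitude a b) G
     *m (basis_mx e) ^t*))%:C%C = (1 - `|G a b| ^+ 2) / 2.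
Proof.
move=> he hG ab Ga Gb; rewrite linear_entropyE // sum_pair_amplitude //.
rewrite !sum_pair_amplitude // Ga Gb normr1.
have -> : `|G b a| = `|G a b| by rewrite -[in LHS]hG !mxE norm_conjC.
by field.
Qed.

Lemma gram_offdiag_le {d n} (U : R -> 'M[C]_(d * n)) (e : 'I_d -> 'cV[C]_d)
    (E0 : 'cV[C]_n) t (E : 'I_d -> 'cV[C]_n) a b :
    orthonormal_basis e -> (forall i, braket (E i) (E i) = 1) ->
    (forall c, normalized c ->
      joint_state U e E0 t c = \sum_i c i *: tensket (e i) (E i)) ->
    a != b ->
  `|gram E a b| ^+ 2 <= (1 - inf (entropy_ratios U e E0 t))%:C%C.
Proof.
move=> he hE hU ab; set ratios := entropy_ratios _ _ _ _.
have herm1 : (1%:M : 'M[C]_d) ^t* = 1%:M.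
  by rewrite tr_scalar_mx map_scalar_mx /= conjC1.
(* [inf] is known to lie below the members of a set only once the set is bounded below. *)
have lb0 : has_lbound ratios.
  exists 0 => _ [c [hc _ ->]].
  rewrite (rhoSE U e E0 t c E) ?hU // rhoS_diagE.
  rewrite divr_ge0 ?linear_entropy_ge0 ?gram_herm // => i j.
    by apply: gram_le1.
  by rewrite mxE normr_nat; case: eqP; rewrite ?expr1n ?expr0n.
pose c := pair_amplitude a b.
have hc : normalized c := normalized_pair_amplitude a b ab.
have Sdiag : (linear_entropy (rhoS_diag e c))%:C%C = 2^-1.
  rewrite rhoS_diagE linear_entropy_pair ?mxE ?eqxx //.
  by rewrite (negPf ab) normr0 expr0n subr0 mul1r.
have Srho : (linear_entropy (rhoS U e E0 t c))%:C%C
    = (1 - `|gram E a b| ^+ 2) / 2.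
  rewrite (rhoSE U e E0 t c E) ?hU // linear_entropy_pair ?gram_herm //.
    by rewrite mxE hE.
  by rewrite mxE hE.
have Sdiag0 : linear_entropy (rhoS_diag e c) != 0.
  apply: contra_eq_neq Sdiag => ->.
  by rewrite eq_sym invr_neq0 // pnatr_eq0.
have : ratios (linear_entropy (rhoS U e E0 t c)
    / linear_entropy (rhoS_diag e c)) by exists c.
(* The two factors 1/2 cancel and the ratio is [1 - |gram E a b|^2]. *)
move=> /(ge_inf lb0); rewrite -lecR rmorphM fmorphV /= Srho Sdiag.
rewrite invrK divfK ?pnatr_eq0 // => le_inf.
by rewrite rmorphB rmorph1 lerBrDr addrC -lerBrDr.
Qed.

End Kets.

Local Open Scope complex_scope.

Theorem mainTheorem2 (R : realType) (d n : nat) (hd : (2 <= d)%N)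
    (e : 'I_d -> 'cV[R[i]]_d) (he : orthonormal_basis e)
    (E0 : 'cV[R[i]]_n) (hE0 : braket E0 E0 = 1)
    (U : R -> 'M[R[i]]_(d * n)) (hU : unitary_evolution U)
    (hcons : conserves_basis U e E0)
    (t : R) (c : 'I_d -> R[i]) (hc : normalized c)
    (F : {vspace 'cV[R[i]]_d}) (PiF : 'M[R[i]]_d)
    (hPiF : orthogonal_projector F PiF) :
  `| \tr (rhoS U e E0 t c *m PiF) - \tr (rhoS_diag e c *m PiF) |
  <= ((\dim F)%:R * Num.sqrt (1 - inf (entropy_ratios U e E0 t)))%:C.
Proof.
have [E [hE hEU]] := hcons t.
have offdiag a b := gram_offdiag_le U e E0 t E a b he hE hEU.
set h := 1 - inf _ in offdiag *.
(* Two distinct indices, 0 and 1, exist because [2 <= d]. Nonnegativity ensures that [Num.sqrt h]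
   squares to [h], as [Num.sqrt] is 0 on negative numbers. *)
have h_ge0 : 0 <= h.
  rewrite -ler0c; have := offdiag (Ordinal (ltnW hd)) (Ordinal hd) isT.
  exact: le_trans (exprn_ge0 _ _).
have [PP trP] := orthogonal_projector_gram_trace F PiF hPiF.
set V := basis_mx e; have VK : V ^t* *m V = 1%:M := basis_mxK e he.
(* The projector in the basis [e]; its trace and Frobenius norm are those of [PiF]. *)
pose Q := V ^t* *m PiF *m V.
have trQ : \tr Q = (\dim F)%:R.
  by rewrite mxtrace_mulC mulmxA (mulmx1C VK) mul1mx.
have QQ : frobenius_sqr Q = (\dim F)%:R.
  rewrite frobenius_sqrE -trQ !trmxC_mul trmxCK /Q !mulmxA.
  by rewrite -(mulmxA _ V) (mulmx1C VK) mulmx1 -(mulmxA _ _ PiF) PP.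
have -> : \tr (rhoS U e E0 t c *m PiF) - \tr (rhoS_diag e c *m PiF)
    = \tr (schur_state c (gram E - 1%:M) *m Q).
  rewrite (rhoSE U e E0 t c E) ?hEU // rhoS_diagE -raddfB /= -mulmxBl.
  rewrite -mulmxBl -mulmxBr schur_stateB /Q [RHS]mxtrace_mulC.
  by rewrite -!mulmxA mxtrace_mulC -!mulmxA mxtrace_mulC -!mulmxA.
have frob_le : frobenius_sqr (schur_state c (gram E - 1%:M)) <= h%:C%C.
  apply: frobenius_schur_state_le => // a b; rewrite mxE.
  (* The diagonal vanishes because the [E i] are unit vectors. *)
  have [<-|ab] := eqVneq a b.
    by rewrite !mxE eqxx hE subrr normr0 expr0n ler0c.
  rewrite [X in _ + X]mxE [X in - X]mxE (negPf ab) subr0; exact: offdiag.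
rewrite -ler_sqr ?nnegrE ?normr_ge0 ?ler0c ?mulr_ge0 ?sqrtr_ge0 //.
apply: le_trans (trmulmx_CauchySchwarz _ _) _; rewrite QQ.
rewrite -rmorphXn /= exprMn sqr_sqrtr // mulrC rmorphM rmorphXn /= rmorph_nat.
(* Cauchy-Schwarz yields the factor [\dim F], while the squared claim carries its square; a natural
   number is at most its square, with 0 treated apart. *)
apply: ler_pM; rewrite ?ler0n ?frobenius_sqr_ge0 // -natrX ler_nat.
by rewrite -[leqLHS]expn1; case: (\dim F) => // m; rewrite leq_pexp2l.
Qed.
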